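(* Let $\phi\in\boldsymbol\Phi$ and assume that the model satisfies the integrability condition $\{\phi(\ell_{\theta,\tilde\theta}),\phi'(\ell_{\theta,\tilde\theta}),\phi^{\#}(\ell_{\theta,\tilde\theta})\}\subset\mathbb L_1(Q)$ for all $\theta,\tilde\theta\in\Theta$ and $Q\in\mathcal Q$. Then the maximum subdivergence estimators and the minimum superdivergence estimators are Fisher consistent, i.e. $$\tilde T_{\phi,\theta}(P_{\theta_0})=\mathrm{argmax}_{\tilde\theta\in\Theta}\ \underline{D}_{\phi,\tilde\theta}(P_\theta,P_{\theta_0})=\theta_0\quad\text{for all }\theta,\theta_0\in\Theta,$$ and $$T_\phi(P_{\theta_0})=\mathrm{argmin}_{\theta\in\Theta}\ \overline{D}_\phi(P_\theta,P_{\theta_0})=\theta_0\quad\text{for all }\theta_0\in\Theta.$$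
   Context: Model: $(\mathcal X,\mathcal A)$ is a measurable space, $\Theta\subset\mathbb R^d$, and $\mathcal P=\{P_\theta:\theta\in\Theta\}$ is a family of nonatomic probability measures ($P_\theta(\{x\})=0$ for all $x$) with densities $p_\theta=\mathrm dP_\theta/\mathrm d\lambda$ with respect to a $\sigma$-finite measure $\lambda$. The family is identifiable ($P_\theta\ne P_{\tilde\theta}$ if $\theta\neq\tilde\theta$) and its members are measure-theoretically equivalent (products of densities are $>0$ $\lambda$-a.s.). $P_0\notin\mathcal P$ is a probability measure with density $p_0$, measure-theoretically equivalent with the members of $\mathcal P$; $\mathcal P^+=\mathcal P\cup\{P_0\}$; $\mathcal P_{\rm emp}$ is the set of empirical measures $P_n=\frac1n\sum_{i=1}^n\delta_{X_i}$; $\mathcal Q=\mathcal P^+\cup\mathcal P_{\rm emp}$. For $f\in\mathbb L_1(Q)$ (the $Q$-absolutely integrable functions) write $Q\cdot f=\int f\,\mathrm dQ$. $\boldsymbol\Phi$ is the class of twice differentiable strictly convex functions $\phi:(0,\infty)\to\mathbb R$ with $\phi(1)=0$, continuously extended (possibly by $+\infty$) to $t=0$. For $\phi\in\boldsymbol\Phi$ put $\phi^{\#}(t)=\phi(t)-t\phi'(t)$. Likelihood ratios: $\ell_{\theta,\tilde\theta}=p_\theta/p_{\tilde\theta}$. Subdivergence: $\underline D_{\phi,\tilde\theta}(P_\theta,Q)=P_\theta\cdot\phi'(\ell_{\theta,\tilde\theta})+Q\cdot\phi^{\#}(\ell_{\theta,\tilde\theta})$ for $\theta,\tilde\theta\in\Theta$,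 $Q\in\mathcal Q$. Superdivergence: $\overline D_\phi(P_\theta,Q)=\sup_{\tilde\theta\in\Theta}\underline D_{\phi,\tilde\theta}(P_\theta,Q)$. Define $\tilde T_{\phi,\theta}(Q)=\mathrm{argmax}_{\tilde\theta}\underline D_{\phi,\tilde\theta}(P_\theta,Q)$ and $T_\phi(Q)=\mathrm{argmin}_\theta\overline D_\phi(P_\theta,Q)$. The maximum subdivergence estimator with escort parameter $\theta$ is $\tilde T_{\phi,\theta}(P_n)$ and the minimum superdivergence estimator is $T_\phi(P_n)$. An estimator $T(P_n)$ is Fisher consistent if $T(P_{\theta})=\theta$ for all $\theta\in\Theta$. *)

(* Defs.v *)
From HB Require Import structures.
From mathcomp Require Import all_boot all_order all_algebra.
From mathcomp Require Import all_classical all_reals all_analysis.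

Set Implicit Arguments.
Unset Strict Implicit.
Unset Printing Implicit Defensive.

Import Order.TTheory GRing.Theory Num.Theory.
Import numFieldNormedType.Exports.

Local Open Scope classical_set_scope.
Local Open Scope ring_scope.

(* The class Phi. A member is a total function R -> R of which only the values
   on ]0, +oo[ matter; see [ext0] for its value at 0. *)
Record Phi_class (R : realType) (phi : R -> R) : Prop := PhiClass {
  Phi_derivable : forall t : R, 0 < t -> derivable phi t 1;
  Phi_derivable2 : forall t : R, 0 < t -> derivable (derive1 phi) t 1;
  Phi_strictly_convex : forall s t a : R,
    0 < s -> 0 < t -> s != t -> 0 < a < 1 ->
    phi (a * s + (1 - a) * t) < a * phi s + (1 - a) * phi t;
  Phi_at1 : phi 1 = 0 }.

(* The continuous extension of phi to 0, whose value there may be +oo. *)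
Definition ext0 (R : realType) (phi : R -> R) (t : R) : \bar R :=
  if 0 < t then (phi t)%:E else lim ((phi s)%:E @[s --> 0^'+]).

Definition sharp (R : realType) (phi : R -> R) (t : R) : R :=
  phi t - t * derive1 phi t.

Section model.
Context {disp : measure_display} {X : measurableType disp} {R : realType}.
Variable d : nat.
Implicit Types (Theta : set 'rV[R]_d) (P : 'rV[R]_d -> probability X R)
  (p : 'rV[R]_d -> X -> R) (Q : probability X R).

(* Equality of probability measures: values on non-measurable sets are
   meaningless, so Leibniz equality of [probability X R] is too fine. *)
Definition same_measure (Q Q' : probability X R) : Prop :=
  forall A, measurable A -> Q A = Q' A.

Definition is_density (lambda : {sigma_finite_measure set X -> \bar R})
    Q (f : X -> R) : Prop :=
  [/\ measurable_fun setT f, (forall x, 0 <= f x) &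
      forall A, measurable A -> Q A = (\int[lambda]_(x in A) (f x)%:E)%E].

(* The parameter set is Theta; P and p are only meaningful on it. *)
Record divergence_model Theta
    (lambda : {sigma_finite_measure set X -> \bar R})
    P p (P0 : probability X R) (p0 : X -> R) : Prop := DivergenceModel {
  model_nonatomic : forall theta, Theta theta ->
    forall x, measurable [set x] /\ P theta [set x] = 0%E;
  model_density : forall theta, Theta theta ->
    is_density lambda (P theta) (p theta);
  model_identifiable : forall theta theta', Theta theta -> Theta theta' ->
    theta != theta' -> ~ same_measure (P theta) (P theta');
  model_equivalent : forall theta theta', Theta theta -> Theta theta' ->
    {ae lambda, forall x, 0 < p theta x * p theta' x};
  model_P0_notin : forall theta, Theta theta -> ~ same_measure P0 (P theta);
  model_P0_density : is_density lambda P0 p0;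
  model_P0_equivalent : forall theta, Theta theta ->
    {ae lambda, forall x, 0 < p0 x * p theta x} }.

Definition empirical Q : Prop :=
  exists n (x : 'I_n -> X), (0 < n)%N /\
    forall A, measurable A ->
      Q A = ((n%:R^-1)%:E * \sum_(i < n) \d_(x i) A)%E.

(* The class Q, that is, the model, P0 and all empirical measures. *)
Definition Qclass Theta P (P0 : probability X R) : set (probability X R) :=
  [set Q | [\/ exists2 theta, Theta theta & same_measure Q (P theta),
               same_measure Q P0 |
               empirical Q]].

(* The likelihood ratio; the points where the denominator vanishes, at which
   division returns 0, form a lambda-null set in a [divergence_model]. *)
Definition lratio p (theta theta' : 'rV[R]_d) (x : X) : R :=
  p theta x / p theta' x.

Definition divergence_integrable (phi : R -> R) Theta P p
    (P0 : probability X R) : Prop :=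
  forall theta theta' Q, Theta theta -> Theta theta' -> Qclass Theta P P0 Q ->
    [/\ Q.-integrable setT (fun x => ext0 phi (lratio p theta theta' x)),
        Q.-integrable setT (fun x => (derive1 phi (lratio p theta theta' x))%:E) &
        Q.-integrable setT (fun x => (sharp phi (lratio p theta theta' x))%:E)].

Definition subdivergence (phi : R -> R) P p (theta' theta : 'rV[R]_d) Q
    : \bar R :=
  (\int[P theta]_x (derive1 phi (lratio p theta theta' x))%:E +
   \int[Q]_x (sharp phi (lratio p theta theta' x))%:E)%E.

Definition superdivergence (phi : R -> R) Theta P p (theta : 'rV[R]_d) Q
    : \bar R :=
  ereal_sup [set subdivergence phi P p theta' theta Q | theta' in Theta].

Definition argmax Theta (f : 'rV[R]_d -> \bar R) : set 'rV[R]_d :=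
  [set t | Theta t /\ forall s, Theta s -> (f s <= f t)%E].

Definition argmin Theta (f : 'rV[R]_d -> \bar R) : set 'rV[R]_d :=
  [set t | Theta t /\ forall s, Theta s -> (f t <= f s)%E].

(* Estimators are the set-valued functionals of all optimal parameters. *)
Definition max_subdivergence (phi : R -> R) Theta P p (theta : 'rV[R]_d) Q
    : set 'rV[R]_d :=
  argmax Theta (fun theta' => subdivergence phi P p theta' theta Q).

Definition min_superdivergence (phi : R -> R) Theta P p Q : set 'rV[R]_d :=
  argmin Theta (fun theta => superdivergence phi Theta P p theta Q).

(* T(P_theta) = theta, as an equality of sets: the optimum exists, is unique
   and equals theta. *)
Definition Fisher_consistent Theta P
    (T : probability X R -> set 'rV[R]_d) : Prop :=
  forall theta, Theta theta -> T (P theta) = [set theta].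

End model.

(* Main.v *)
Require Import Defs.
From mathcomp Require Import all_boot all_order all_algebra.
From mathcomp Require Import all_classical all_reals all_analysis.
From mathcomp Require Import measurable_realfun ring lra.

(** Fix [theta] and [theta0], and write [a], [b], [c] for the densities of
    [P theta], [P theta'], [P theta0], all positive almost everywhere, and [r = a / c], [s = a / b] for the two
    likelihood ratios. Moving both integrals of the subdivergence at the
    escort [theta'] to the dominating measure gives the integrand
      [phi'(s) a + (phi(s) - s phi'(s)) c = c (phi(s) + phi'(s) (r - s))],
    because [a = r c]. This is [c] times the value at [r] of the tangent to
    [phi] at [s]. Convexity puts it below [c phi(r)], which is what the same
    formula gives at [theta' = theta0], where [s = r]; strict convexity makes
    the inequality strict wherever [s != r], that is, wherever [b != c]. So if
    [theta'] did as well as [theta0], the densities [b] and [c] would agree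
    almost everywhere and identifiability would give [theta' = theta0]. This is
    [subdivergence_lt]: the subdivergence has [theta0] as its only maximizer,
    whatever [theta] is.

    Hence the superdivergence of [theta] at [P theta0] is attained at the escort
    [theta0]. The escort [theta] itself always gives the value 0, since the
    likelihood ratio is then 1 and [phi(1) = 0] ([subdivergence_diag]). For
    [theta != theta0] the escort [theta] is not the maximizer, so the
    superdivergence exceeds 0; for [theta = theta0] the two escorts coincide
    and it equals 0. Thus [theta0] is the only minimizer of the
    superdivergence. *)

Set Implicit Arguments.
Unset Strict Implicit.
Unset Printing Implicit Defensive.

Import Order.TTheory GRing.Theory Num.Theory.
Import numFieldNormedType.Exports.

Local Open Scope classical_set_scope.
Local Open Scope ring_scope.
Local Open Scope charge_scope.

(** * Strict convexity and tangents *)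

Lemma Phi_tangent_le (R : realType) (phi : R -> R) (s t : R) :
  Phi_class phi -> 0 < s -> 0 < t ->
  phi s + derive1 phi s * (t - s) <= phi t.
Proof.
move=> hphi s0 t0; have [->|st] := eqVneq s t; first by rewrite subrr mulr0 addr0.
have dphi : differentiable phi s.
  exact/derivable1_diffP/(Phi_derivable hphi).
have -> : derive1 phi s * (t - s) = 'D_(t - s) phi s.
  rewrite derive1E' // deriveE // mulrC.
  have -> : t - s = (t - s) *: (1 : R) by rewrite /GRing.scale /= mulr1.
  by rewrite linearZ /= [in LHS]/GRing.scale /= mulr1.
rewrite -lerBrDl.
have /cvg_dnbhs_at_right cD : derivable phi s (t - s) by exact: diff_derivable.
rewrite /derive; move: (cD) => /cvg_lim <- //.
apply: limr_le; first by apply/cvg_ex; eexists; exact: cD.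
(* the difference quotient in direction [t - s] at step [a] in ]0, 1[ is at most
   [phi t - phi s] by convexity *)
near=> a.
have a0 : 0 < a by near: a; exact: nbhs_right_gt.
have a1 : a < 1 by near: a; exact: nbhs_right_lt.
rewrite /= /GRing.scale/= ler_pdivrMl//.
have := Phi_strictly_convex hphi t0 s0 _ (_ : 0 < a < 1).
rewrite a0 a1 eq_sym => /(_ st isT).
have -> : a * t + (1 - a) * s = a * (t - s) + s by ring.
lra.
Unshelve. all: by end_near. Qed.

(** The tangent inequality at the midpoint of [s] and [t] combines with strict
    convexity there: passing to the limit in the chord slopes alone would lose
    strictness. *)
Lemma Phi_tangent_lt (R : realType) (phi : R -> R) (s t : R) :
  Phi_class phi -> 0 < s -> 0 < t -> s != t ->
  phi s + derive1 phi s * (t - s) < phi t.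
Proof.
move=> hphi s0 t0 st.
have half01 : 0 < 2^-1 :> R /\ 2^-1 < 1 :> R by lra.
have := Phi_strictly_convex hphi s0 t0 st (introT andP half01).
set m := _ + _ * t => lt_m.
have m0 : 0 < m by rewrite /m; lra.
have := Phi_tangent_le hphi s0 m0.
have -> : m - s = 2^-1 * (t - s) by rewrite /m; field.
rewrite mulrCA; lra.
Qed.

(** * Integration against a density *)

Lemma measurable_integrable_EFin (disp : measure_display)
    (X : measurableType disp) (R : realType) (mu : {measure set X -> \bar R})
    (g : X -> R) :
  mu.-integrable setT (EFin \o g) -> measurable_fun setT g.
Proof. by move=> ig; apply/measurable_EFinP; exact: measurable_int ig. Qed.

Section density.
Context (disp : measure_display) (X : measurableType disp) (R : realType).
Variable lambda : {sigma_finite_measure set X -> \bar R}.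

Lemma density_dominates (Q : probability X R) (f : X -> R) :
  is_density lambda Q f -> Q `<< lambda.
Proof.
move=> [mf f0 Qf]; apply/null_content_dominatesP => A mA A0.
rewrite Qf // null_set_integral //.
by apply/measurable_EFinP/measurable_funTS.
Qed.

Lemma density_ae (Q : probability X R) (f : X -> R) (S : X -> Prop) :
  is_density lambda Q f -> {ae lambda, forall x, S x} -> {ae Q, forall x, S x}.
Proof.
move=> df [N [mN N0 SN]]; exists N; split => //.
by have /null_content_dominatesP -> := density_dominates df.
Qed.

Lemma density_ae_unique (Q Q' : probability X R) (f f' : X -> R) :
  is_density lambda Q f -> is_density lambda Q' f' ->
  {ae lambda, forall x, f x = f' x} -> same_measure Q Q'.
Proof.
move=> [mf f0 Qf] [mf' f'0 Qf'] ff' A mA; rewrite Qf // Qf' //.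
apply: ae_eq_integral => //.
- by apply/measurable_EFinP/measurable_funTS.
- by apply/measurable_EFinP/measurable_funTS.
- by apply: filterS ff' => x -> _.
Qed.

(** This identification makes the change of variables known for the
    Radon-Nikodym derivative available for any given density. *)
Lemma density_Radon_Nikodym (Q : probability X R) (f : X -> R) :
  is_density lambda Q f ->
  ae_eq lambda setT ('d (charge_of_finite_measure Q) '/d lambda) (EFin \o f).
Proof.
move=> df; have Ql := density_dominates df; have [mf f0 Qf] := df.
apply: integral_ae_eq => //.
- exact: Radon_Nikodym_integrable.
- exact/measurable_EFinP.
- by move=> A _ mA; rewrite -Radon_Nikodym_integral// -Qf.
Qed.

Lemma integral_density (Q : probability X R) (f g : X -> R) :
  is_density lambda Q f -> Q.-integrable setT (EFin \o g) ->
  (\int[lambda]_x (g x * f x)%:E = \int[Q]_x (g x)%:E)%E.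
Proof.
move=> df ig; have Ql := density_dominates df; have [mf _ _] := df.
have mg : measurable_fun setT g by exact: measurable_integrable_EFin ig.
rewrite -[RHS](Radon_Nikodym_change_of_variables Ql)//.
apply: ae_eq_integral => //.
- by apply/measurable_EFinP; exact: measurable_funM.
- apply: emeasurable_funM; first exact/measurable_EFinP.
  by apply: measurable_int; exact: Radon_Nikodym_integrable.
- by apply: filterS (density_Radon_Nikodym df) => x /= /(_ I) -> _; rewrite EFinM.
Qed.

Lemma integrable_density (Q : probability X R) (f g : X -> R) :
  is_density lambda Q f -> Q.-integrable setT (EFin \o g) ->
  lambda.-integrable setT (EFin \o (fun x => g x * f x)).
Proof.
move=> df ig; have [mf f0 _] := df.
have mg : measurable_fun setT g by exact: measurable_integrable_EFin ig.
apply/integrableP; split.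
  by apply/measurable_EFinP; exact: measurable_funM.
under eq_integral do rewrite /= normrM (ger0_norm (f0 _)).
have ig' : Q.-integrable setT (EFin \o (fun x => `|g x|)).
  exact: (integrable_abse ig).
rewrite (integral_density df ig').
by case/integrableP : ig.
Qed.

End density.

(** This converts an inequality between integrals, in the direction opposite to
    the one known pointwise, into a pointwise almost everywhere equality. *)
Lemma integral_le0_ae0 (disp : measure_display) (X : measurableType disp)
    (R : realType) (mu : {measure set X -> \bar R}) (h : X -> R) :
  measurable_fun setT h -> {ae mu, forall x, 0 <= h x} ->
  (\int[mu]_x (h x)%:E <= 0)%E -> {ae mu, forall x, h x = 0}.
Proof.
move=> mh h0 ih.
have mEh : measurable_fun setT (EFin \o h) by exact/measurable_EFinP.
have /(ae_eq_integral_abs mu measurableT mEh) : (\int[mu]_x `|(EFin \o h) x| = 0)%E.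
  apply/eqP; rewrite eq_le integral_ge0 ?andbT; last by move=> x _; exact: abse_ge0.
  rewrite (ae_eq_integral (EFin \o h)) //.
  - exact: measurableT_comp.
  - by apply: filterS h0 => x hx _ /=; rewrite ger0_norm.
by apply: filterS => x /(_ I) [].
Qed.

(** * Subdivergences and their maximizers *)

Section fisher.
Context (R : realType) (disp : measure_display) (X : measurableType disp).
Context (d : nat) (Theta : set 'rV[R]_d).
Context (lambda : {sigma_finite_measure set X -> \bar R}).
Context (P : 'rV[R]_d -> probability X R) (p : 'rV[R]_d -> X -> R).
Context (P0 : probability X R) (p0 : X -> R) (phi : R -> R).
Hypothesis hmodel : divergence_model Theta lambda P p P0 p0.
Hypothesis hphi : Phi_class phi.
Hypothesis hint : divergence_integrable phi Theta P p P0.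

Lemma model_gt0 theta : Theta theta -> {ae lambda, forall x, 0 < p theta x}.
Proof.
move=> Tt; have [_ pt0 _] := model_density hmodel Tt.
apply: filterS (model_equivalent hmodel Tt Tt) => x pp.
by rewrite lt0r pt0 andbT; apply: contraTneq pp => ->; rewrite mul0r ltxx.
Qed.

Lemma model_integrable theta theta' theta0 :
  Theta theta -> Theta theta' -> Theta theta0 ->
  (P theta0).-integrable setT
     (EFin \o (fun x => derive1 phi (lratio p theta theta' x))) /\
  (P theta0).-integrable setT
     (EFin \o (fun x => sharp phi (lratio p theta theta' x))).
Proof.
move=> Tt Tt' Tt0.
have QT : Qclass Theta P P0 (P theta0) by apply: Or31; exists theta0.
by have [_ ? ?] := hint Tt Tt' QT.
Qed.

(** The subdivergence at [P theta0] mixes integrals against two measures; this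
    is the integrand obtained by moving both to [lambda], which makes two
    escorts comparable pointwise. *)
Definition subdiv_density theta' theta theta0 (x : X) : R :=
  derive1 phi (lratio p theta theta' x) * p theta x +
  sharp phi (lratio p theta theta' x) * p theta0 x.

Lemma subdiv_density_integrable theta' theta theta0 :
  Theta theta -> Theta theta' -> Theta theta0 ->
  lambda.-integrable setT (EFin \o subdiv_density theta' theta theta0).
Proof.
move=> Tt Tt' Tt0.
have [i1 _] := model_integrable Tt Tt' Tt.
have [_ i2] := model_integrable Tt Tt' Tt0.
have := integrableD measurableT
  (integrable_density (model_density hmodel Tt) i1)
  (integrable_density (model_density hmodel Tt0) i2).
by apply: eq_integrable.
Qed.

Lemma subdivergenceE theta' theta theta0 :
  Theta theta -> Theta theta' -> Theta theta0 ->
  subdivergence phi P p theta' theta (P theta0) =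
  (\int[lambda]_x (subdiv_density theta' theta theta0 x)%:E)%E.
Proof.
move=> Tt Tt' Tt0.
have [i1 _] := model_integrable Tt Tt' Tt.
have [_ i2] := model_integrable Tt Tt' Tt0.
rewrite /subdivergence -(integral_density (model_density hmodel Tt) i1).
rewrite -(integral_density (model_density hmodel Tt0) i2).
rewrite -integralD_EFin//.
- exact: integrable_density (model_density hmodel Tt) i1.
- exact: integrable_density (model_density hmodel Tt0) i2.
Qed.

(** With [p theta x = r * p theta0 x], the terms in [derive1 phi r] cancel and
    what remains is the gap between [phi] and its tangent at [s], evaluated at
    [r]. *)
Lemma subdiv_density_gap theta' theta theta0 x :
  0 < p theta' x -> 0 < p theta0 x ->
  let r := lratio p theta theta0 x in let s := lratio p theta theta' x in
  subdiv_density theta0 theta theta0 x - subdiv_density theta' theta theta0 x =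
  p theta0 x * (phi r - (phi s + derive1 phi s * (r - s))).
Proof.
move=> p'0 p00 r s.
have pE : p theta x = r * p theta0 x by rewrite /r /lratio divfK ?gt_eqF.
rewrite /subdiv_density -/r -/s /sharp pE; ring.
Qed.

(** A failure would force the nonnegative gap of [subdiv_density_gap] to vanish
    almost everywhere; by strict convexity the two likelihood ratios then agree,
    hence so do the densities, against identifiability. *)
Lemma subdivergence_lt theta' theta theta0 :
  Theta theta -> Theta theta' -> Theta theta0 -> theta' != theta0 ->
  (subdivergence phi P p theta' theta (P theta0) <
   subdivergence phi P p theta0 theta (P theta0))%E.
Proof.
move=> Tt Tt' Tt0 ne.
rewrite ltNge; apply/negP => le_sub.
have i' := subdiv_density_integrable Tt Tt' Tt0.
have i0 := subdiv_density_integrable Tt Tt0 Tt0.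
pose h x := subdiv_density theta0 theta theta0 x
            - subdiv_density theta' theta theta0 x.
have pos : {ae lambda, forall x,
    [/\ 0 < p theta x, 0 < p theta' x & 0 < p theta0 x]}.
  by apply: filterS3 (model_gt0 Tt) (model_gt0 Tt') (model_gt0 Tt0).
have mh : measurable_fun setT h.
  apply: measurable_funB; first exact: measurable_integrable_EFin i0.
  exact: measurable_integrable_EFin i'.
have h0 : {ae lambda, forall x, 0 <= h x}.
  apply: filterS pos => x [pt pt' pt0].
  rewrite /h subdiv_density_gap //; apply: mulr_ge0; first exact: ltW.
  by rewrite subr_ge0; apply: Phi_tangent_le => //; exact: divr_gt0.
have ih : (\int[lambda]_x (h x)%:E <= 0)%E.
  rewrite /h; under eq_integral do rewrite EFinB.
  by rewrite integralB_EFin // -!subdivergenceE // sube_le0.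
have hz := integral_le0_ae0 mh h0 ih.
apply: (model_identifiable hmodel Tt' Tt0 ne).
apply: (density_ae_unique (model_density hmodel Tt') (model_density hmodel Tt0)).
apply: filterS2 pos hz => x [pt pt' pt0].
rewrite /h subdiv_density_gap // => /eqP; rewrite mulf_eq0 gt_eqF//=.
have [rs _|rs] := eqVneq (lratio p theta theta' x) (lratio p theta theta0 x).
  (* equal ratios share the positive numerator, so the denominators agree *)
  by move: rs; rewrite /lratio => /(mulfI (lt0r_neq0 pt)) /invr_inj.
by rewrite gt_eqF// subr_gt0 Phi_tangent_lt // divr_gt0.
Qed.

Lemma subdivergence_le theta' theta theta0 :
  Theta theta -> Theta theta' -> Theta theta0 ->
  (subdivergence phi P p theta' theta (P theta0) <=
   subdivergence phi P p theta0 theta (P theta0))%E.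
Proof.
move=> Tt Tt' Tt0; have [->|ne] := eqVneq theta' theta0; first exact: lexx.
exact/ltW/subdivergence_lt.
Qed.

Lemma lratio_diag_ae theta theta0 : Theta theta -> Theta theta0 ->
  {ae P theta0, forall x, lratio p theta theta x = 1}.
Proof.
move=> Tt Tt0; apply: (density_ae (model_density hmodel Tt0)).
by apply: filterS (model_gt0 Tt) => x pt; rewrite /lratio divff ?gt_eqF.
Qed.

Lemma subdivergence_diag theta theta0 : Theta theta -> Theta theta0 ->
  subdivergence phi P p theta theta (P theta0) = 0%E.
Proof.
move=> Tt Tt0.
have cstE (Q : probability X R) (g : R -> R) : Q.-integrable setT
      (EFin \o (fun x => g (lratio p theta theta x))) ->
    {ae Q, forall x, lratio p theta theta x = 1} ->
    (\int[Q]_x (g (lratio p theta theta x))%:E = (g 1)%:E)%E.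
  move=> ig r1; transitivity (\int[Q]_x (g 1)%:E)%E; last first.
    rewrite integral_cst // -[RHS]mule1; congr (_ * _)%E.
    exact: probability_setT.
  apply: ae_eq_integral => //.
  - exact: measurable_int ig.
  - by apply: filterS r1 => x -> _.
have [i1 _] := model_integrable Tt Tt Tt.
have [_ i2] := model_integrable Tt Tt Tt0.
have e1 := cstE _ (derive1 phi) i1 (lratio_diag_ae Tt Tt).
have e2 := cstE _ (sharp phi) i2 (lratio_diag_ae Tt Tt0).
rewrite /subdivergence e1 e2 -EFinD /sharp (Phi_at1 hphi) mul1r sub0r.
by congr EFin; exact: subrr.
Qed.

(** * Fisher consistency *)

Lemma max_subdivergence_consistent theta : Theta theta ->
  Fisher_consistent Theta P (max_subdivergence phi Theta P p theta).
Proof.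
move=> Tt theta0 Tt0; apply/seteqP; split => [t [Tt' max_t]|_ ->] /=.
  apply/eqP/negPn/negP => /(subdivergence_lt Tt Tt' Tt0).
  by rewrite ltNge max_t.
split=> [|s Ts]; first exact: Tt0.
 exact: subdivergence_le.
Qed.

Lemma superdivergenceE theta theta0 : Theta theta -> Theta theta0 ->
  superdivergence phi Theta P p theta (P theta0) =
  subdivergence phi P p theta0 theta (P theta0).
Proof.
move=> Tt Tt0; apply/eqP; rewrite eq_le; apply/andP; split.
  apply: ge_ereal_sup => _ [s Ts <-].
  exact: subdivergence_le.
by apply: ereal_sup_ubound; exists theta0.
Qed.

(** Both superdivergences in the comparison are subdivergences at the escort
    [theta0]. At [theta0] this is a diagonal value 0; at [t != theta0] it
    strictly exceeds the value at the escort [t], which is again diagonal and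
    so 0. *)
Lemma min_superdivergence_consistent :
  Fisher_consistent Theta P (min_superdivergence phi Theta P p).
Proof.
move=> theta0 Tt0.
have gt0 t : Theta t -> t != theta0 ->
    (superdivergence phi Theta P p theta0 (P theta0) <
     superdivergence phi Theta P p t (P theta0))%E.
  move=> Tt ne; rewrite !superdivergenceE // subdivergence_diag //.
  by rewrite -(subdivergence_diag Tt Tt0) subdivergence_lt.
apply/seteqP; split => [t [Tt min_t]|_ ->] /=.
  apply/eqP/negPn/negP => /(gt0 _ Tt).
  by rewrite ltNge min_t.
split=> [|s Ts]; first exact: Tt0.
have [->|ne] := eqVneq s theta0; first exact: lexx.
exact/ltW/gt0.
Qed.

End fisher.

Theorem theorem2p2 (R : realType) (disp : measure_display)
    (X : measurableType disp) (d : nat) (Theta : set 'rV[R]_d)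
    (lambda : {sigma_finite_measure set X -> \bar R})
    (P : 'rV[R]_d -> probability X R) (p : 'rV[R]_d -> X -> R)
    (P0 : probability X R) (p0 : X -> R) (phi : R -> R)
    (hmodel : divergence_model Theta lambda P p P0 p0)
    (hphi : Phi_class phi)
    (hint : divergence_integrable phi Theta P p P0) :
  (forall theta : 'rV[R]_d, Theta theta ->
     Fisher_consistent Theta P (max_subdivergence phi Theta P p theta)) /\
  Fisher_consistent Theta P (min_superdivergence phi Theta P p).
Proof.
split; last exact: (min_superdivergence_consistent hmodel hphi hint).
by move=> theta Tt; exact: (max_subdivergence_consistent hmodel hphi hint).
Qed.
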